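(* Let $\mathbb{P}$ be the set of all prime numbers and $2\mathbb{P}=\{2p\mid p\in\mathbb{P}\}$, let $m\in\mathbb{N}$, and let $\mathcal{C}(m,\mathbb{P}\cup 2\mathbb{P})\neq\emptyset$ and $\mathcal{C}(m+t,\mathbb{P}\cup 2\mathbb{P})\neq\emptyset$ for some integer $t\geq 4$. Let $$w=\max\{u\in\Vert\mathcal{C}(m,\mathbb{N})\Vert \mid u\in\mathbb{P}\cup 2\mathbb{P}\}.$$ Suppose that $w\in 2\mathbb{P}$ and that there exists an axis $\mathbb{L}_{[x],[y]}$ of $\mathcal{C}(m+t,\mathbb{N})$ (that is, $x,y\in\mathbb{N}$ with $x+y=m+t$) with $x\in\mathbb{P}$ and $x<y$ such that $y>w>m-x$. Then there exists a generator $s\in\mathbb{N}$ with $m<s<m+t$ such that $\mathcal{C}(s,\mathbb{P}\cup 2\mathbb{P})\neq\emptyset$.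
   Context: $\mathbb{N}=\{1,2,3,\dots\}$. For $n\in\mathbb{N}$ and $\mathbb{M}\subseteq\mathbb{N}$, the circle of partition with generator $n$ and base set $\mathbb{M}$ is $\mathcal{C}(n,\mathbb{M})=\{[x]\mid x\in\mathbb{M},\ n-x\in\mathbb{M}\}$. The weight of a point $[x]$ is $\Vert[x]\Vert:=x$, and $\Vert\mathcal{C}(n,\mathbb{M})\Vert=\{x\mid [x]\in\mathcal{C}(n,\mathbb{M})\}$ is the set of weights; in particular $\Vert\mathcal{C}(n,\mathbb{N})\Vert=\{1,2,\dots,n-1\}$. An axis $\mathbb{L}_{[x],[y]}$ of $\mathcal{C}(n,\mathbb{M})$ is a pair of points $[x],[y]\in\mathcal{C}(n,\mathbb{M})$ with $x+y=n$. *)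

(* Defs.v *)
From mathcomp Require Import all_boot all_order all_classical.
Set Implicit Arguments.
Unset Strict Implicit.
Unset Printing Implicit Defensive.
Local Open Scope classical_set_scope.

(* The natural numbers start at 1. *)
Definition posnat : set nat := [set n | 0 < n].

(* The formal point [x]; a point is distinguished from its weight x. *)
Record point := Point { weight : nat }.

(* Since subtraction on nat is truncated, [weight p < n] is needed for
   [n - weight p] to be the true difference; when M only has positive elements
   it is implied by [M (n - weight p)]. *)
Definition circle (n : nat) (M : set nat) : set point :=
  [set p | [/\ M (weight p), weight p < n & M (n - weight p)]].

Definition weights (C : set point) : set nat := weight @` C.

Definition axis (n : nat) (M : set nat) (p q : point) : Prop :=
  [/\ circle n M p, circle n M q & weight p + weight q = n].

Definition primeset : set nat := [set p | prime p].

Definition twoprimes : set nat := [set 2 * p | p in primeset].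

Definition is_max (A : set nat) (w : nat) : Prop := A w /\ ubound A w.

(* Main.v *)
Require Import Defs.
From mathcomp Require Import all_boot all_order all_classical.
Set Implicit Arguments.
Unset Strict Implicit.
Unset Printing Implicit Defensive.
Local Open Scope classical_set_scope.

(** The generator is [s = x + w]: both [x] and [w] lie in the base set, so the
    circle with generator [x + w] contains the point of weight [x], and the two
    inequalities [m - x < w] and [w < y], shifted by [x], become [m < s] and
    [s < x + y = m + t]. *)

(** The points of weights [a] and [b] form an axis of the circle with generator
    [a + b]; positivity of [b] keeps the weight [a] strictly below the
    generator. *)
Lemma circle_add_nonempty (M : set nat) (a b : nat) :
  M a -> M b -> 0 < b -> circle (a + b) M !=set0.
Proof.
move=> Ma Mb b_gt0; exists (Point a); split=> //=.
- by rewrite -[X in X < _]addn0 ltn_add2l.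
- by rewrite addKn.
Qed.

Theorem proposition3p6 (m t w : nat)
  (hm : posnat m) (ht : 4 <= t)
  (hCm : circle m (primeset `|` twoprimes) !=set0)
  (hCmt : circle (m + t) (primeset `|` twoprimes) !=set0)
  (hw : is_max [set u | weights (circle m posnat) u /\
                        (primeset `|` twoprimes) u] w)
  (hw2 : twoprimes w)
  (hax : exists x y : nat,
    [/\ axis (m + t) posnat (Point x) (Point y),
        primeset x, x < y, w < y & m - x < w]) :
  exists s : nat,
    [/\ posnat s, m < s, s < m + t
      & circle s (primeset `|` twoprimes) !=set0].
Proof.
have [x [y [[_ _ /= xy_sum] x_prime _ w_lt_y mx_lt_w]]] := hax.
have w_gt0 : 0 < w by exact: leq_ltn_trans mx_lt_w.
exists (x + w); split.
- by rewrite /posnat /= addn_gt0 w_gt0 orbT.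
- by apply: leq_ltn_trans (leq_maxr x m) _; rewrite maxnE ltn_add2l.
- by rewrite -xy_sum ltn_add2l.
- by apply: circle_add_nonempty => //; [left | right].
Qed.
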